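(* Suppose the following hold, with constants $c_0,\gamma,\alpha,k_0,k_1,k_2,\lambda>0$ and $s>1$ independent of $\ell$. (i) The cost $c_\ell$ of evaluating the (unnormalized) density $\pi^{(\ell)}$ satisfies $c_\ell\le c_0 s^{\gamma\ell}$ for all $\ell\in\mathbb{N}$. (ii) $\mathrm{KL}(\mu_0\,\|\,\pi^{(\ell)})\le k_0$ and $\mathrm{KL}(\pi^{(\ell)}\,\|\,\pi)\le k_1 s^{-\alpha\ell}$ for all $\ell\in\mathbb{N}$. (iii) For every initial distribution $\nu_0$ and every $\ell\in\mathbb{N}$, $\mathrm{KL}(\nu_t\,\|\,\pi^{(\ell)})\le e^{-\lambda t}\,\mathrm{KL}(\nu_0\,\|\,\pi^{(\ell)})$, where $\nu_t$ solves the mean-field SVGD equation with target $\pi^{(\ell)}$ at time $t$, started from $\nu_0$. (iv) $\mathrm{KL}(\pi^{(\ell-1)}\,\|\,\pi^{(\ell)})\le k_2 s^{-\alpha\ell}$ for all $\ell\ge2$. Then, for a tolerance $\epsilon>0$, continuous MLSVGD (with suitably selected level $L$ and integration times $T_1,\dots,T_L$) gives $\mu^{\mathrm{ML}}$ with $d_{\mathrm{Hell}}(\mu^{\mathrm{ML}},\pi)\le\epsilon$ with costs bounded as $$c_{\mathrm{ML}}^*(\epsilon)\le\frac{2c_0s^{2\gamma}}{\lambda\gamma\log(s)}\left(\frac{\sqrt{2k_1}}{\epsilon}\right)^{2\gamma/\alpha}\log\left(\frac{\sqrt{\epsilon^2+2(k_2+R)}}{\epsilon}\right),$$ where $R$ is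 a constant bounding the remainders $R_\ell$ defined in the context, that is, $R_\ell\le R$ for all $\ell$.
   Context: Let $\Theta\subset\mathbb{R}^d$ be measurable. All distributions are probability measures on $\Theta$ with densities with respect to Lebesgue measure, identified with their densities. The target is $\pi$; $(\pi^{(\ell)})_{\ell\ge1}$ is a sequence of distributions converging weakly to $\pi$; $\mu_0$ is a fixed initial distribution; $c_\ell$ is the cost of evaluating the unnormalized density of $\pi^{(\ell)}$. $\mathrm{KL}(\mu\,\|\,\eta)=\int\mu\log(\mu/\eta)\,d\theta$ and $d_{\mathrm{Hell}}(\mu,\eta)=\sqrt{\tfrac12\int(\sqrt{\mu}-\sqrt{\eta})^2\,d\theta}$. Mean-field SVGD (Stein variational gradient descent) equation with target $\eta$ and kernel $K:\mathbb{R}^d\times\mathbb{R}^d\to\mathbb{R}$ of a reproducing kernel Hilbert space: $$\partial_t\nu_t(\theta)=-\nabla\cdot\Big(\nu_t(\theta)\,\mathbb{E}_{\theta'\sim\nu_t}\big[K(\theta',\theta)\nabla\log\eta(\theta')+\nabla_1K(\theta',\theta)\big]\Big),$$ where $\nabla_1$ is the gradient in the first argument. Continuous MLSVGD (multilevel SVGD) with integration times $T_1,\dots,T_L$: $\mu^{(1)}_{T_1}$ is the solution at time $T_1$ of the mean-field SVGD equation with target $\pi^{(1)}$ started from $\mu_0$; for $\ell\ge2$, $\mu^{(\ell)}_{T_\ell}$ is the solution at time $T_\ell$ with target $\pi^{(\ell)}$ started from $\mu^{(\ell-1)}_{T_{\ell-1}}$. With $L$ levels the output is $\mu^{\mathrm{ML}}=\mu^{(L)}_{T_L}$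 and the cost is $\sum_{\ell=1}^L c_\ell T_\ell$. Remainder: $$R_\ell=\int_{\Theta}\big(\mu^{(\ell-1)}_{T_{\ell-1}}(\theta)-\pi^{(\ell-1)}(\theta)\big)\log\left(\frac{\pi^{(\ell-1)}(\theta)}{\pi^{(\ell)}(\theta)}\right)d\theta.$$ The sequence $(R_\ell)$ is taken to be bounded: since $\pi^{(\ell)}$ converges to $\pi$, $\log(\pi^{(\ell-1)}/\pi^{(\ell)})\to0$ pointwise, and $\mu^{(\ell)}_{T_\ell}\to\pi^{(\ell)}$ as $T_\ell\to\infty$, one has $R_\ell\to0$, so that there is a constant $R\ge R_\ell$ for all $\ell$.
   Formalization: For an arbitrary R bounding the remainders (uniformly in the times) and every ε the bound fails (k_1→0); it is proved for all ε if R is large enough, for any R if ε is small, and for any R if ε ≤ √(2k_1) and k_0 ≤ ε²/2+k_2+R. *)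

(* Defs.v *)
From HB Require Import structures.
From mathcomp Require Import all_boot all_order all_algebra.
From mathcomp Require Import all_classical all_reals all_analysis.
Import Order.TTheory GRing.Theory Num.Theory.
Import numFieldNormedType.Exports.

Set Implicit Arguments.
Unset Strict Implicit.
Unset Printing Implicit Defensive.

Local Open Scope classical_set_scope.
Local Open Scope ring_scope.

(* R^d = 'rV[R]_d carries the product sigma-algebra of its coordinates
   (= the Borel sigma-algebra), as the library does for tuples.         *)

Definition rV_coord (R : realType) (d : nat) (i : 'I_d) (x : 'rV[R]_d) : R :=
  x ord0 i.

Definition rV_display : measure_display.
Proof. exact: default_measure_display. Qed.

Lemma rV_measurable_bigcup (R : realType) (d : nat) (F : (set 'rV[R]_d)^nat) :
  (forall k, g_sigma_preimage (@rV_coord R d) (F k)) ->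
  g_sigma_preimage (@rV_coord R d) (\bigcup_k F k).
Proof. exact: sigma_algebra_bigcup. Qed.

HB.instance Definition _ (R : realType) (d : nat) :=
  @isMeasurable.Build rV_display 'rV[R]_d (g_sigma_preimage (@rV_coord R d))
    (@sigma_algebra0 _ _ _) (@sigma_algebraC _ _) (@rV_measurable_bigcup R d).

Lemma measurable_rV_coord (R : realType) (d : nat) (i : 'I_d) :
  measurable_fun setT (@rV_coord R d i).
Proof.
move=> _ Y mY; rewrite setTI; apply: sub_sigma_algebra => /=.
rewrite -bigcup_seq/=; exists i => /=; first by rewrite mem_index_enum.
by exists Y => //; rewrite setTI.
Qed.

Lemma measurable_to_rV dT (T : measurableType dT) (R : realType) (d : nat)
    (f : T -> 'rV[R]_d) :
  (forall i, measurable_fun setT (@rV_coord R d i \o f)) ->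
  measurable_fun setT f.
Proof.
move=> mf.
suff h : preimage_set_system setT f (@measurable _ 'rV[R]_d) `<=` measurable.
  by move=> _ A mA; apply: h; exists A.
have -> : preimage_set_system setT f (@measurable _ 'rV[R]_d) =
    g_sigma_preimage (fun i => @rV_coord R d i \o f).
  by rewrite g_sigma_preimage_comp.
apply: smallest_sub; first exact: sigma_algebra_measurable.
case: d => [|d] in f mf *; first by rewrite big_ord0.
rewrite -bigcup_mkord_ord; apply: bigcup_sub => i Ii.
by move=> A [B mB <-]; exact: mf.
Qed.

Definition rV_cons (R : realType) (d : nat) (p : R * 'rV[R]_d) : 'rV[R]_d.+1 :=
  \row_j (if unlift ord0 j is Some k then p.2 ord0 k else p.1).

Definition rV_uncons (R : realType) (d : nat) (x : 'rV[R]_d.+1) :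
  R * 'rV[R]_d := (x ord0 ord0, \row_j x ord0 (lift ord0 j)).

Lemma rV_consK (R : realType) (d : nat) : cancel (@rV_cons R d) (@rV_uncons R d).
Proof.
move=> [a v]; rewrite /rV_cons /rV_uncons; congr pair; first by rewrite mxE unlift_none.
by apply/rowP => j; rewrite !mxE liftK.
Qed.

Lemma measurable_rV_cons (R : realType) (d : nat) :
  measurable_fun setT (@rV_cons R d).
Proof.
apply: measurable_to_rV => i.
case: (unliftP ord0 i) => [k ->|->].
  rewrite (_ : _ \o _ = @rV_coord R d k \o snd); last first.
    by apply/funext => p; rewrite /= /rV_coord mxE liftK.
  by apply: measurableT_comp => //; exact: measurable_rV_coord.
rewrite (_ : _ \o _ = fst) //.
by apply/funext => p; rewrite /= /rV_coord mxE unlift_none.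
Qed.

Lemma measurable_rV_uncons (R : realType) (d : nat) :
  measurable_fun setT (@rV_uncons R d).
Proof.
apply: measurable_fun_pair; first exact: measurable_rV_coord.
apply: measurable_to_rV => i.
rewrite (_ : _ \o _ = @rV_coord R d.+1 (lift ord0 i)); last first.
  by apply/funext => x; rewrite /= /rV_coord mxE.
exact: measurable_rV_coord.
Qed.

Section lebesgue_rV_step.
Context (R : realType) (d : nat)
  (mu : {sigma_finite_measure set 'rV[R]_d -> \bar R}).

Definition lebesgue_rV_succ : set 'rV[R]_d.+1 -> \bar R :=
  pushforward (lebesgue_measure \x mu)%E (@rV_cons R d).

Let step0 : lebesgue_rV_succ set0 = 0%E.
Proof. by rewrite /lebesgue_rV_succ /pushforward preimage_set0 measure0. Qed.

Let step_ge0 A : (0 <= lebesgue_rV_succ A)%E.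
Proof. by rewrite /lebesgue_rV_succ /pushforward; exact: measure_ge0. Qed.

Let step_sigma_additive : semi_sigma_additive lebesgue_rV_succ.
Proof.
have mpre A : measurable A -> measurable (@rV_cons R d @^-1` A).
  by move=> mA; rewrite -[X in measurable X]setTI; exact: measurable_rV_cons.
move=> F mF tF mUF; rewrite /lebesgue_rV_succ /pushforward preimage_bigcup.
apply: measure_semi_sigma_additive.
- by move=> n; exact: mpre.
- apply/trivIsetP => /= i j _ _ ij; rewrite -preimage_setI.
  by move/trivIsetP : tF => /(_ _ _ _ _ ij) ->//; rewrite preimage_set0.
- by rewrite -preimage_bigcup; exact: mpre.
Qed.

HB.instance Definition _ := isMeasure.Build _ _ _ lebesgue_rV_succ
  step0 step_ge0 step_sigma_additive.

Let step_sigma_finite : sigma_finite setT lebesgue_rV_succ.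
Proof.
have /sigma_finiteP[F [TF ndF Foo]] := sigma_finiteT (@lebesgue_measure R).
have /sigma_finiteP[G [TG ndG Goo]] := sigma_finiteT mu.
exists (fun n => @rV_uncons R d @^-1` (F n `*` G n)).
  apply/esym; rewrite -subTset => x _ /=.
  have [n _ Fn] : (\bigcup_n F n) (rV_uncons x).1 by rewrite -TF.
  have [k _ Gk] : (\bigcup_n G n) (rV_uncons x).2 by rewrite -TG.
  exists (maxn n k) => //; split.
  - by move: Fn; exact/subsetPset/ndF/leq_maxl.
  - by move: Gk; exact/subsetPset/ndG/leq_maxr.
move=> k; have [mF Fk] := Foo k; have [mG Gk] := Goo k; split.
  by rewrite -[X in measurable X]setTI; apply: measurable_rV_uncons => //;
    exact: measurableX.
rewrite /lebesgue_rV_succ /pushforward -comp_preimage.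
rewrite (_ : _ \o _ = idfun); last by apply/funext => p; exact: rV_consK.
by rewrite preimage_id product_measure1E// lte_mul_pinfty// ge0_fin_numE.
Qed.

HB.instance Definition _ :=
  Measure_isSigmaFinite.Build _ _ _ lebesgue_rV_succ step_sigma_finite.

End lebesgue_rV_step.

Fixpoint lebesgue_rV (R : realType) (d : nat) :
    {sigma_finite_measure set 'rV[R]_d -> \bar R} :=
  if d is d'.+1 then lebesgue_rV_succ (lebesgue_rV R d')
  else \d_(0 : 'rV[R]_0).

Lemma lebesgue_rV_box (R : realType) (d : nat) (A : 'I_d -> set R) :
  (forall i, measurable (A i)) ->
  lebesgue_rV R d [set x : 'rV[R]_d | forall i, A i (x ord0 i)] =
  (\prod_(i < d) lebesgue_measure (A i))%E.
Proof.
elim: d A => [|d IH] A mA.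
  by rewrite big_ord0 /= diracE mem_set //= => -[].
rewrite big_ord_recl -IH //= /lebesgue_rV_succ /pushforward.
have mB : measurable [set x : 'rV[R]_d | forall i, A (lift ord0 i) (x ord0 i)].
  rewrite (_ : [set x : 'rV[R]_d | _] =
      \bigcap_(i in [set: 'I_d]) (@rV_coord R d i @^-1` A (lift ord0 i))).
    apply: fin_bigcap_measurable => // i _.
    rewrite -[X in measurable X]setTI.
    exact: (@measurable_rV_coord R d i measurableT _ (mA (lift ord0 i))).
  by apply/seteqP; split => x /= h i; [move=> _|]; exact: h.
rewrite -product_measure1E //; last exact: mA.
congr (product_measure1 _ _ _); apply/seteqP; split => -[a v] /=.
  move=> h; split; first by have := h ord0; rewrite mxE unlift_none.
  by move=> i; have := h (lift ord0 i); rewrite mxE liftK.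
move=> [h0 h] i; rewrite mxE.
by case: (unliftP ord0 i) => [k ->|->] //=; exact: h.
Qed.

(* Only the values on Theta, up to Lebesgue-null sets, are meaningful. *)
Record density (R : realType) (d : nat) (Theta : set 'rV[R]_d) := Density {
  dens :> 'rV[R]_d -> R;
  dens_measurable : measurable_fun Theta dens;
  dens_ge0 : forall x, Theta x -> 0 <= dens x;
  dens_mass : (\int[lebesgue_rV R d]_(x in Theta) (dens x)%:E = 1)%E }.

Definition weak_cvg (R : realType) (d : nat) (Theta : set 'rV[R]_d)
    (mu : nat -> density Theta) (eta : density Theta) : Prop :=
  forall f : 'rV[R]_d -> R, continuous f ->
    (exists M : R, forall x, `|f x| <= M) ->
    (fun l => \int[lebesgue_rV R d]_(x in Theta) (f x * mu l x))
      @ \oo --> \int[lebesgue_rV R d]_(x in Theta) (f x * eta x).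

(* p log (p / q) with the conventions 0 log (0 / q) = 0 and
   p log (p / 0) = +oo for p > 0. *)
Definition kl_integrand (R : realType) (p q : R) : \bar R :=
  if p == 0 then 0%E else if q == 0 then +oo%E else (p * ln (p / q))%:E.

Definition KL (R : realType) (d : nat) (Theta : set 'rV[R]_d)
    (mu eta : density Theta) : \bar R :=
  (\int[lebesgue_rV R d]_(x in Theta) kl_integrand (mu x) (eta x))%E.

Definition hellinger (R : realType) (d : nat) (Theta : set 'rV[R]_d)
    (mu eta : density Theta) : R :=
  Num.sqrt (2^-1 * \int[lebesgue_rV R d]_(x in Theta)
                     (Num.sqrt (mu x) - Num.sqrt (eta x)) ^+ 2).

(* H, with inner product ip, is a Hilbert space of real functions on X in
   which K x represents evaluation at x. *)
Record rkhs_with_kernel (R : realType) (X : Type) (H : set (X -> R))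
    (ip : (X -> R) -> (X -> R) -> R) (K : X -> X -> R) : Prop := RKHS {
  rkhs0 : H (fun=> 0);
  rkhsP : forall (a : R) (f g : X -> R), H f -> H g ->
    H (fun x => a * f x + g x);
  rkhs_sym : forall f g, H f -> H g -> ip f g = ip g f;
  rkhs_linear : forall (a : R) (f g h : X -> R), H f -> H g -> H h ->
    ip (fun x => a * f x + g x) h = a * ip f h + ip g h;
  rkhs_gt0 : forall f, H f -> f <> (fun=> 0) -> 0 < ip f f;
  rkhs_complete : forall u : nat -> X -> R, (forall n, H (u n)) ->
    (forall e : R, 0 < e -> exists N, forall m n, (N <= m)%N -> (N <= n)%N ->
       ip (fun x => u m x - u n x) (fun x => u m x - u n x) < e) ->
    exists2 f, H f &
      (fun n => ip (fun x => u n x - f x) (fun x => u n x - f x)) @ \oo --> 0;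
  rkhs_kernel : forall x, H (K x);
  rkhs_reproducing : forall f x, H f -> ip f (K x) = f x }.

Definition reproducing_kernel (R : realType) (X : Type) (K : X -> X -> R) :=
  exists H ip, @rkhs_with_kernel R X H ip K.

Definition grad (R : realType) (d : nat) (f : 'rV[R]_d -> R) (x : 'rV[R]_d) :
  'rV[R]_d := \row_i 'D_(delta_mx ord0 i) f x.

Definition dotp (R : realType) (d : nat) (u v : 'rV[R]_d) : R :=
  \sum_i u ord0 i * v ord0 i.

Definition svgd_integrand (R : realType) (d : nat)
    (K : 'rV[R]_d -> 'rV[R]_d -> R) (eta : 'rV[R]_d -> R)
    (theta theta' : 'rV[R]_d) : 'rV[R]_d :=
  K theta' theta *: grad (fun x => ln (eta x)) theta'
  + grad (fun x => K x theta) theta'.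

Definition svgd_velocity (R : realType) (d : nat) (Theta : set 'rV[R]_d)
    (K : 'rV[R]_d -> 'rV[R]_d -> R) (eta nu : density Theta)
    (theta : 'rV[R]_d) : 'rV[R]_d :=
  \row_i \int[lebesgue_rV R d]_(theta' in Theta)
    (nu theta' * svgd_integrand K eta theta theta' ord0 i).

Definition test_function (R : realType) (d : nat) (phi : 'rV[R]_d -> R) : Prop :=
  [/\ forall x, differentiable phi x, continuous (grad phi) &
      compact (closure [set x | phi x != 0])].

(* The terms of the velocity of nu are defined: the target is positive and its
   logarithm differentiable nu-a.e., and for a.e. theta so is K(., theta), with
   integrable expectation. *)
Definition svgd_velocity_defined (R : realType) (d : nat)
    (Theta : set 'rV[R]_d) (K : 'rV[R]_d -> 'rV[R]_d -> R)
    (eta nu : density Theta) : Prop :=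
  {ae lebesgue_rV R d, forall theta', Theta theta' -> nu theta' != 0 ->
    0 < eta theta' /\ differentiable (fun x => ln (eta x)) theta'} /\
  {ae lebesgue_rV R d, forall theta, Theta theta ->
    {ae lebesgue_rV R d, forall theta', Theta theta' -> nu theta' != 0 ->
      differentiable (fun x => K x theta) theta'} /\
    forall i, (lebesgue_rV R d).-integrable Theta
      (fun theta' => (nu theta' * svgd_integrand K eta theta theta' ord0 i)%:E)}.

(* Weak solutions of d_t nu = - div (nu v) started from nu0: the equation is
   tested against phi in C^1_c(R^d), nu_t being extended by 0 outside Theta, so
   that the total mass on Theta is conserved. *)
Record mean_field_svgd (R : realType) (d : nat) (Theta : set 'rV[R]_d)
    (K : 'rV[R]_d -> 'rV[R]_d -> R) (eta nu0 : density Theta)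
    (nu : R -> density Theta) : Prop := MeanFieldSVGD {
  svgd_initial : {ae lebesgue_rV R d, forall x, Theta x -> nu 0 x = nu0 x};
  svgd_defined : forall t : R, 0 <= t -> svgd_velocity_defined K eta (nu t);
  svgd_flux : forall (phi : 'rV[R]_d -> R) (t : R), test_function phi -> 0 <= t ->
    (lebesgue_rV R d).-integrable Theta
      (fun x => (nu t x * dotp (grad phi x) (svgd_velocity K eta (nu t) x))%:E);
  svgd_continuous0 : forall phi : 'rV[R]_d -> R, test_function phi ->
    (fun t : R => \int[lebesgue_rV R d]_(x in Theta) (phi x * nu t x)) @ 0^'+
      --> \int[lebesgue_rV R d]_(x in Theta) (phi x * nu 0 x);
  svgd_equation : forall (phi : 'rV[R]_d -> R) (t : R), test_function phi -> 0 < t ->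
    is_derive t (1 : R)
      (fun t : R => \int[lebesgue_rV R d]_(x in Theta) (phi x * nu t x))
      (\int[lebesgue_rV R d]_(x in Theta)
        (nu t x * dotp (grad phi x) (svgd_velocity K eta (nu t) x))) }.

(* flow l nu0 t is the solution at time t, started from nu0, of the mean-field
   SVGD equation with target pi^(l).  mlsvgd _ _ _ l is mu^(l)_{T_l}, with
   mu^(0)_{T_0} = mu_0. *)
Fixpoint mlsvgd (R : realType) (d : nat) (Theta : set 'rV[R]_d)
    (flow : nat -> density Theta -> R -> density Theta) (mu0 : density Theta)
    (T : nat -> R) (l : nat) : density Theta :=
  if l is l'.+1 then flow l (mlsvgd flow mu0 T l') (T l) else mu0.

Definition mlsvgd_cost (R : realType) (c T : nat -> R) (L : nat) : R :=
  \sum_(1 <= l < L.+1) c l * T l.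

Definition remainder_integrand (R : realType) (d : nat) (Theta : set 'rV[R]_d)
    (pi : nat -> density Theta)
    (flow : nat -> density Theta -> R -> density Theta) (mu0 : density Theta)
    (T : nat -> R) (l : nat) (x : 'rV[R]_d) : R :=
  (mlsvgd flow mu0 T l.-1 x - pi l.-1 x) * ln (pi l.-1 x / pi l x).

Definition remainder (R : realType) (d : nat) (Theta : set 'rV[R]_d)
    (pi : nat -> density Theta)
    (flow : nat -> density Theta -> R -> density Theta) (mu0 : density Theta)
    (T : nat -> R) (l : nat) : R :=
  \int[lebesgue_rV R d]_(x in Theta) remainder_integrand pi flow mu0 T l x.

(* The integration times depend on the bound, so the bound has to be uniform
   in them.  R_l starts at l = 2, the first level with a predecessor. *)
Definition remainders_bounded_by (R : realType) (d : nat)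
    (Theta : set 'rV[R]_d) (pi : nat -> density Theta)
    (flow : nat -> density Theta -> R -> density Theta) (mu0 : density Theta)
    (Rb : R) : Prop :=
  forall (T : nat -> R) (l : nat), (forall k, 0 <= T k) -> (2 <= l)%N ->
    (lebesgue_rV R d).-integrable Theta
      (EFin \o remainder_integrand pi flow mu0 T l) /\
    remainder pi flow mu0 T l <= Rb.

Definition mlsvgd_cost_bound (R : realType)
    (c0 gamma alpha k1 k2 lambda s Rb eps : R) : R :=
  2 * c0 * s `^ (2 * gamma) / (lambda * gamma * ln s)
  * (Num.sqrt (2 * k1) / eps) `^ (2 * gamma / alpha)
  * ln (Num.sqrt (eps ^+ 2 + 2 * (k2 + Rb)) / eps).

Definition mlsvgd_attains (R : realType) (d : nat) (Theta : set 'rV[R]_d)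
    (pi_lim : density Theta)
    (flow : nat -> density Theta -> R -> density Theta) (mu0 : density Theta)
    (c : nat -> R) (eps bound : R) : Prop :=
  exists (L : nat) (T : nat -> R),
    [/\ (1 <= L)%N, forall l, 0 <= T l,
        hellinger (mlsvgd flow mu0 T L) pi_lim <= eps &
        mlsvgd_cost c T L <= bound].

(* Main.v *)
(* Since p ln (p / q) >= p - q + (sqrt p - sqrt q)^2 pointwise, twice the squared
   Hellinger distance is at most KL.  Splitting ln (mu / eta') along
   ln (mu / eta) + ln (eta / eta') gives
     KL(mu^(l-1) || pi^(l)) <= KL(mu^(l-1) || pi^(l-1)) + KL(pi^(l-1) || pi^(l)) + R_l,
   so if T_l reduces eps^2 / 2 + k2 + R to eps^2 / 2, every level ends with
   KL(mu^(l) || pi^(l)) <= eps^2 / 2.  The level L is taken just large enough for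
   the bias KL(pi^(L) || pi) to be at most eps^2 / 2, and the cost is a geometric
   sum.  If k0 > eps^2 / 2 + k2 + R, level 1 needs a bounded extra time.  For small
   tolerances its cost fits into the slack left by the geometric sum, which is
   proportional to T_2 and hence unbounded.  For eps > sqrt (2 k1) one level
   suffices if R is large, and no flow at all is needed if eps >= 1. *)

Require Import Defs.
From mathcomp Require Import all_boot all_order all_algebra.
From mathcomp Require Import all_classical all_reals all_analysis.
From mathcomp Require Import measurable_realfun ring lra.
Import Order.TTheory GRing.Theory Num.Theory.
Import numFieldNormedType.Exports.

Local Open Scope classical_set_scope.
Local Open Scope ring_scope.

(** * Integrability from two-sided and one-sided bounds *)

Lemma integrable_le_le d (T : measurableType d) (R : realType)
    (mu : {measure set T -> \bar R}) (D : set T) (f g h : T -> \bar R) :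
  measurable D -> measurable_fun D f ->
  mu.-integrable D g -> mu.-integrable D h ->
  (forall x, D x -> (g x <= f x <= h x)%E) -> mu.-integrable D f.
Proof.
move=> mD mf ig ih gfh.
apply: (le_integrable mD mf _
  (integrableD mD (integrable_abse ig) (integrable_abse ih))).
move=> x Dx; have /andP[gf fh] := gfh _ Dx.
rewrite [leRHS]gee0_abs; last by apply: adde_ge0; exact: abse_ge0.
have [f0|f0] := leP 0%E (f x).
  by rewrite gee0_abs// (le_trans fh)// (le_trans (lee_abs _))// leeDr ?abse_ge0.
rewrite lte0_abs// (@le_trans _ _ (- g x)%E)//; first by rewrite leeN2.
by rewrite /= -(abseN (g x)) (le_trans (lee_abs _))// leeDl ?abse_ge0.
Qed.

(** The minorant makes the integral of the negative part finite. Since the integral of [f] is a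
    difference of two nonnegative terms, its being below +oo then forces the positive part to be
    finite too. *)
Lemma integrable_ge_lty d (T : measurableType d) (R : realType)
    (mu : {measure set T -> \bar R}) (D : set T) (f g : T -> \bar R) :
  measurable D -> measurable_fun D f -> mu.-integrable D g ->
  (forall x, D x -> (g x <= f x)%E) ->
  (\int[mu]_(x in D) f x < +oo)%E -> mu.-integrable D f.
Proof.
move=> mD mf ig gf; rewrite integralE => foo.
have neg_oo : (\int[mu]_(x in D) f^\- x < +oo)%E.
  apply: le_lt_trans (integrable_lty mD (integrable_funeneg mD ig)).
  apply: ge0_le_integral => //; first exact: measurable_funeneg.
    by apply: measurable_funeneg; exact: measurable_int ig.
  by move=> x Dx; rewrite !funenegE ge_max !le_max leeN2 gf// lexx orbT.
have neg_fin : (\int[mu]_(x in D) f^\- x)%E \is a fin_num.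
  by rewrite ge0_fin_numE// integral_ge0.
have pos_oo : (\int[mu]_(x in D) f^\+ x < +oo)%E.
  move: foo; rewrite lteBlDr// => /lt_le_trans; apply.
  by rewrite addye ?leey// -ltNye (lt_le_trans _ (integral_ge0 _ _)).
apply/integrableP; split => //.
rewrite (_ : (fun x => _) = (f^\+ \+ f^\-)%E); last by rewrite -fune_abse.
rewrite ge0_integralD//; [exact: lte_add_pinfty|exact: measurable_funepos|].
exact: measurable_funeneg.
Qed.

(** * Pointwise properties of the KL integrand *)

Lemma measurable_sqrtr (R : realType) : measurable_fun setT (@Num.sqrt R).
Proof. by apply: continuous_measurable_fun => x; exact: sqrt_continuous. Qed.

Lemma measurable_kl_integrand d (T : measurableType d) (R : realType)
    (D : set T) (p q : T -> R) :
  measurable D -> measurable_fun D p -> measurable_fun D q ->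
  (forall x, D x -> 0 <= p x) -> (forall x, D x -> 0 <= q x) ->
  measurable_fun D (fun x => kl_integrand (p x) (q x)).
Proof.
move=> mD mp mq p0 q0.
(* Away from the zeros of [p] and [q] the logarithm of the quotient splits, so that measurability
   reduces to that of [ln], [p] and [q]. *)
pose f x := if p x == 0 then 0%E else if q x == 0 then +oo%E
  else (p x * (ln (p x) - ln (q x)))%:E.
apply: (eq_measurable_fun f).
  move=> x /set_mem Dx; rewrite /f /kl_integrand.
  case: eqP => // /eqP px; case: eqP => // /eqP qx.
  by rewrite ln_div// posrE lt_neqAle eq_sym ?px ?qx ?p0 ?q0.
have meq (g : T -> R) : measurable_fun D g -> measurable_fun D (fun x => g x == 0).
  by move=> mg; exact: measurable_fun_eqr.
apply: measurable_fun_if => //; first exact: meq.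
apply: measurable_fun_if => //.
- by apply: (meq p mp) => //.
- apply: measurable_funS (meq q mq) => //; exact: subIsetl.
- apply: (measurable_funS mD); first by move=> x [[]].
  apply/measurable_EFinP; apply: measurable_funM => //.
  by apply: measurable_funB; apply: measurableT_comp => //; exact: measurable_ln.
Qed.

(** With a = sqrt p and b = sqrt q, p ln (p / q) = - 2 a^2 ln (b / a). The bound ln x <= x - 1 makes
    this at least 2 a^2 - 2 a b, which is a^2 - b^2 + (a - b)^2. *)
Lemma kl_integrand_ge (R : realType) (p q : R) : 0 <= p -> 0 <= q ->
  ((p - q + (Num.sqrt p - Num.sqrt q) ^+ 2)%:E <= kl_integrand p q)%E.
Proof.
move=> p0 q0; rewrite /kl_integrand.
case: eqP => [->|/eqP pN0].
  by rewrite sqrtr0 !sub0r sqrrN sqr_sqrtr// addNr.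
case: eqP => [->|/eqP qN0]; first by rewrite leey.
have pp : 0 < p by rewrite lt_neqAle eq_sym pN0.
have qp : 0 < q by rewrite lt_neqAle eq_sym qN0.
rewrite lee_fin.
have := sqr_sqrtr p0; have := sqr_sqrtr q0.
have := pp; have := qp; rewrite -(sqrtr_gt0 p) -(sqrtr_gt0 q).
set a := Num.sqrt p; set b := Num.sqrt q => b0 a0 <- <-.
have ln_ratio : ln (a ^+ 2 / b ^+ 2) = - (2 * ln (b / a)).
  by rewrite !ln_div ?posrE ?exprn_gt0// !lnXn//; ring.
rewrite ln_ratio.
have ln_le : ln (b / a) <= b / a - 1.
  have -> : b / a = 1 + (b / a - 1) by ring.
  by rewrite [leRHS]addrAC subrr add0r le_ln1Dx// ltrBrDl subrr divr_gt0.
have /(ler_wpM2l (sqr_ge0 a)) := ln_le.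
rewrite mulrBr mulr1 (_ : a ^+ 2 * (b / a) = a * b); last by field; rewrite gt_eqF.
nra.
Qed.

(** For positive arguments this is an equality, by additivity of the logarithm. In the degenerate
    cases either a KL term on the right is +oo, or m = 0 and the two terms in p cancel. *)
Lemma kl_integrand_le_remainder (R : realType) (m p q : R) :
  0 <= m -> 0 <= p -> 0 <= q ->
  (kl_integrand m q <=
   kl_integrand m p + kl_integrand p q + ((m - p) * ln (p / q))%:E)%E.
Proof.
move=> m0 p0 q0; rewrite /kl_integrand.
have [->|pN0] := eqVneq p 0.
  have [->|mN0] := eqVneq m 0; first by rewrite subrr mul0r !adde0.
  by rewrite !addye// leey.
have [->|qN0] := eqVneq q 0.
  by rewrite addey ?addye ?leey//; case: ifP.
have [->|mN0] := eqVneq m 0.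
  by rewrite add0e -EFinD lee_fin sub0r mulNr subrr.
have mp : 0 < m by rewrite lt_neqAle eq_sym mN0.
have pp : 0 < p by rewrite lt_neqAle eq_sym pN0.
have qp : 0 < q by rewrite lt_neqAle eq_sym qN0.
by rewrite -!EFinD lee_fin !ln_div ?posrE// le_eqVlt; apply/orP; left; apply/eqP; ring.
Qed.

(** * KL divergence and Hellinger distance of densities *)

Lemma integrable_dens (R : realType) (d : nat) (Theta : set 'rV[R]_d)
    (mu : density Theta) : measurable Theta ->
  (lebesgue_rV R d).-integrable Theta (EFin \o mu).
Proof.
move=> mTheta; apply/integrableP; split.
  by apply/measurable_EFinP; exact: dens_measurable.
rewrite (eq_integral (EFin \o mu)).
  by rewrite dens_mass ltry.
by move=> x /set_mem Tx; rewrite /= ger0_norm// dens_ge0.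
Qed.

Lemma Rintegral_dens (R : realType) (d : nat) (Theta : set 'rV[R]_d)
    (mu : density Theta) : \int[lebesgue_rV R d]_(x in Theta) mu x = 1.
Proof. by rewrite /Rintegral dens_mass. Qed.

Lemma measurable_KL_integrand (R : realType) (d : nat) (Theta : set 'rV[R]_d)
    (mu eta : density Theta) : measurable Theta ->
  measurable_fun Theta (fun x => kl_integrand (mu x) (eta x)).
Proof.
by move=> mTheta; apply: measurable_kl_integrand => //;
  [exact: dens_measurable|exact: dens_measurable|exact: dens_ge0|exact: dens_ge0].
Qed.

Lemma integrable_densB (R : realType) (d : nat) (Theta : set 'rV[R]_d)
    (mu eta : density Theta) : measurable Theta ->
  (lebesgue_rV R d).-integrable Theta (fun x => (mu x - eta x)%:E).
Proof.
by move=> mTheta; apply: (integrableB mTheta (integrable_dens _ _ _ mu mTheta)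
  (integrable_dens _ _ _ eta mTheta)).
Qed.

Lemma kl_integrand_geB (R : realType) (p q : R) : 0 <= p -> 0 <= q ->
  ((p - q)%:E <= kl_integrand p q)%E.
Proof.
move=> p0 q0; apply: le_trans (kl_integrand_ge _ p q p0 q0).
by rewrite lee_fin lerDl sqr_ge0.
Qed.

(** The integrable minorant is [mu - eta], so finiteness of the integral suffices. *)
Lemma integrable_KL (R : realType) (d : nat) (Theta : set 'rV[R]_d)
    (mu eta : density Theta) : measurable Theta -> (KL mu eta < +oo)%E ->
  (lebesgue_rV R d).-integrable Theta (fun x => kl_integrand (mu x) (eta x)).
Proof.
move=> mTheta; apply: integrable_ge_lty => //; last first.
- by move=> x Tx; apply: kl_integrand_geB; exact: dens_ge0.
- exact: integrable_densB.
- exact: measurable_KL_integrand.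
Qed.

Lemma integrable_hellinger (R : realType) (d : nat) (Theta : set 'rV[R]_d)
    (mu eta : density Theta) : measurable Theta ->
  (lebesgue_rV R d).-integrable Theta
    (fun x => ((Num.sqrt (mu x) - Num.sqrt (eta x)) ^+ 2)%:E).
Proof.
move=> mTheta.
have msqrt (nu : density Theta) :
    measurable_fun Theta (fun x => Num.sqrt (nu x)).
  apply: measurableT_comp; first exact: measurable_sqrtr.
  exact: dens_measurable.
apply: (integrable_le_le _ _ _ _ _ _ _ _ _ _ (integrable0 _ _)
  (integrableD mTheta (integrable_dens _ _ _ mu mTheta)
    (integrable_dens _ _ _ eta mTheta))) => //.
  by apply/measurable_EFinP; apply: measurable_funX; exact: measurable_funB.
move=> x Tx; rewrite lee_fin sqr_ge0/= -EFinD lee_fin.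
have mu0 := dens_ge0 mu Tx; have eta0 := dens_ge0 eta Tx.
rewrite -{2}(sqr_sqrtr mu0) -{2}(sqr_sqrtr eta0).
have := sqrtr_ge0 (mu x); have := sqrtr_ge0 (eta x).
nra.
Qed.

Lemma hellinger_ge0 (R : realType) (d : nat) (Theta : set 'rV[R]_d)
    (mu eta : density Theta) : 0 <= hellinger mu eta.
Proof. exact: sqrtr_ge0. Qed.

Lemma sqr_hellinger (R : realType) (d : nat) (Theta : set 'rV[R]_d)
    (mu eta : density Theta) :
  hellinger mu eta ^+ 2 = 2^-1 * \int[lebesgue_rV R d]_(x in Theta)
     (Num.sqrt (mu x) - Num.sqrt (eta x)) ^+ 2.
Proof.
rewrite sqr_sqrtr// mulr_ge0 ?invr_ge0//; apply: Rintegral_ge0 => x _.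
exact: sqr_ge0.
Qed.

(** Pointwise, (sqrt p - sqrt q)^2 <= p + q, and two densities have total mass 2. This settles
    tolerances of at least 1. *)
Lemma hellinger_le1 (R : realType) (d : nat) (Theta : set 'rV[R]_d)
    (mu eta : density Theta) : measurable Theta -> hellinger mu eta <= 1.
Proof.
move=> mTheta; rewrite -(@ler_pXn2r _ 2)// ?nnegrE ?hellinger_ge0//.
rewrite sqr_hellinger expr1n ler_pdivrMl// mulr1.
rewrite (_ : 2 = \int[lebesgue_rV R d]_(x in Theta) (mu x + eta x)); last first.
  rewrite RintegralD//; [|exact: integrable_dens|exact: integrable_dens].
  by rewrite !Rintegral_dens.
apply: le_Rintegral => //; first exact: integrable_hellinger.
  exact: (integrableD mTheta (integrable_dens _ _ _ mu mTheta)
    (integrable_dens _ _ _ eta mTheta)).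
move=> x Tx; have mu0 := dens_ge0 mu Tx; have eta0 := dens_ge0 eta Tx.
rewrite -{2}(sqr_sqrtr mu0) -{2}(sqr_sqrtr eta0).
have := sqrtr_ge0 (mu x); have := sqrtr_ge0 (eta x).
nra.
Qed.

(** Comes from (x + y)^2 <= 2 x^2 + 2 y^2 under the integral. The factors 2 are those of
    [sqr_hellinger_le_KL], so the right side is bounded by a sum of two divergences. *)
Lemma sqr_hellingerD (R : realType) (d : nat) (Theta : set 'rV[R]_d)
    (mu nu eta : density Theta) : measurable Theta ->
  hellinger mu eta ^+ 2 <=
  2 * hellinger mu nu ^+ 2 + 2 * hellinger nu eta ^+ 2.
Proof.
move=> mTheta; rewrite !sqr_hellinger !mulrA divff// !mul1r.
rewrite -RintegralD//; try exact: integrable_hellinger.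
rewrite ler_pdivrMl// -RintegralZl//; last first.
  exact: (integrableD mTheta (integrable_hellinger _ _ _ mu nu mTheta)
    (integrable_hellinger _ _ _ nu eta mTheta)).
apply: le_Rintegral => //; first exact: integrable_hellinger.
  apply: (integrableZl mTheta 2
    (integrableD mTheta (integrable_hellinger _ _ _ mu nu mTheta)
    (integrable_hellinger _ _ _ nu eta mTheta))).
move=> x Tx.
set a := Num.sqrt _; set b := Num.sqrt _; set e := Num.sqrt _.
have := sqr_ge0 ((a - e) - (e - b)); nra.
Qed.

Lemma sqr_hellinger_le_KL (R : realType) (d : nat) (Theta : set 'rV[R]_d)
    (mu eta : density Theta) : measurable Theta ->
  ((2 * hellinger mu eta ^+ 2)%:E <= KL mu eta)%E.
Proof.
move=> mTheta; have [KLoo|] := ltP (KL mu eta) +oo%E; last first.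
  by rewrite leye_eq => /eqP ->; rewrite leey.
rewrite sqr_hellinger mulrA divff// mul1r.
(* Both densities have mass 1, so adding [mu - eta] leaves the integral unchanged and produces the
   minorant of [kl_integrand_ge]. *)
have -> : \int[lebesgue_rV R d]_(x in Theta)
      (Num.sqrt (mu x) - Num.sqrt (eta x)) ^+ 2 =
    \int[lebesgue_rV R d]_(x in Theta)
      ((mu x - eta x) + (Num.sqrt (mu x) - Num.sqrt (eta x)) ^+ 2).
  rewrite RintegralD//; [|exact: integrable_densB|exact: integrable_hellinger].
  rewrite RintegralB//; [|exact: integrable_dens|exact: integrable_dens].
  by rewrite !Rintegral_dens subrr add0r.
have isum := integrableD mTheta (integrable_densB _ _ _ mu eta mTheta)
  (integrable_hellinger _ _ _ mu eta mTheta).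
rewrite /Rintegral fineK; last exact: (integrable_fin_num mTheta isum).
apply: (le_integral mTheta isum); first exact: integrable_KL.
by move=> x /set_mem Tx; apply: kl_integrand_ge; exact: dens_ge0.
Qed.

Lemma KL_ge0 (R : realType) (d : nat) (Theta : set 'rV[R]_d)
    (mu eta : density Theta) : measurable Theta -> (0 <= KL mu eta)%E.
Proof.
move=> mTheta; apply: le_trans (sqr_hellinger_le_KL _ _ _ mu eta mTheta).
by rewrite lee_fin mulr_ge0// sqr_ge0.
Qed.

(** The pointwise inequality is integrated. Its left side is integrable because it lies between
    [mu - eta'] and the integrable right side. *)
Lemma KL_le_remainder (R : realType) (d : nat) (Theta : set 'rV[R]_d)
    (mu eta eta' : density Theta) : measurable Theta ->
  (KL mu eta < +oo)%E -> (KL eta eta' < +oo)%E ->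
  (lebesgue_rV R d).-integrable Theta
    (fun x => ((mu x - eta x) * ln (eta x / eta' x))%:E) ->
  (KL mu eta' <= KL mu eta + KL eta eta' +
    (\int[lebesgue_rV R d]_(x in Theta)
       ((mu x - eta x) * ln (eta x / eta' x)))%:E)%E.
Proof.
move=> mTheta KL1 KL2 irem.
have i1 := integrable_KL _ _ _ _ _ mTheta KL1.
have i2 := integrable_KL _ _ _ _ _ mTheta KL2.
have i12 := integrableD mTheta i1 i2.
have ub x : Theta x -> (kl_integrand (mu x) (eta' x) <=
    kl_integrand (mu x) (eta x) + kl_integrand (eta x) (eta' x) +
    ((mu x - eta x) * ln (eta x / eta' x))%:E)%E.
  by move=> Tx; apply: kl_integrand_le_remainder; exact: dens_ge0.
rewrite /Rintegral fineK; last exact: integrable_fin_num.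
rewrite /KL -integralD// -integralD//.
apply: (le_integral mTheta _ (integrableD mTheta i12 irem));
  last by move=> x /set_mem; exact: ub.
apply: (integrable_le_le _ _ _ _ _ _ _ _ mTheta _
  (integrable_densB _ _ _ mu eta' mTheta) (integrableD mTheta i12 irem)).
  exact: measurable_KL_integrand.
move=> x Tx; apply/andP; split; last exact: ub.
by apply: kl_integrand_geB; exact: dens_ge0.
Qed.

(** * Rounding to a level, geometric sums and the logarithmic factor *)

Lemma exists_level (R : realType) (s y : R) : 1 < s -> 1 <= y ->
  exists2 L : nat, (1 <= L)%N & y <= s `^ L%:R <= s * y.
Proof.
move=> s1 y1; have s0 : 0 < s by exact: lt_trans s1.
have y0 : 0 < y by exact: lt_le_trans y1.
have lns : 0 < ln s by exact: ln_gt0.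
have x0 : 0 <= ln y / ln s by rewrite divr_ge0 ?ln_ge0// ltW.
have /andP[le_x lt_x] := truncn_itv x0.
(* The successor of the integer part of log_s y exceeds log_s y by at most 1, which costs at most
   one factor [s], and is at least 1 even for y = 1. *)
exists (Num.truncn (ln y / ln s)).+1 => //.
move: (Num.truncn _) le_x lt_x => m le_x lt_x.
have sm0 : 0 < s `^ m.+1%:R by exact: powR_gt0.
have ln_sm : ln (s `^ m.+1%:R) = m.+1%:R * ln s by exact: ln_powR.
have ln_sy : ln (s * y) = ln s + ln y by rewrite lnM ?posrE.
apply/andP; split.
  by rewrite -ler_ln ?posrE// ln_sm -ler_pdivrMr// ltW.
rewrite -ler_ln ?posrE ?mulr_gt0// ln_sm ln_sy -natr1 mulrDl mul1r addrC lerD2l.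
by rewrite -ler_pdivlMr.
Qed.

Lemma sum_expr_geom (R : comNzRingType) (r : R) (L : nat) :
  (r - 1) * \sum_(1 <= l < L.+1) r ^+ l = r * (r ^+ L - 1).
Proof.
elim: L => [|L IH]; first by rewrite big_geq// mulr0 expr0 subrr mulr0.
by rewrite big_nat_recr//= mulrDr IH exprS; ring.
Qed.

(** Makes the logarithm in the integration times and in the cost bound nonnegative. *)
Lemma sqrt_ratio_ge1 (R : realType) (eps A : R) : 0 < eps -> 0 <= A ->
  1 <= Num.sqrt (eps ^+ 2 + 2 * A) / eps.
Proof.
move=> eps0 A0; have e2 : 0 < eps ^+ 2 by exact: exprn_gt0.
rewrite ler_pdivlMr// mul1r -[leLHS](ger0_norm (ltW eps0)) -sqrtr_sqr.
by rewrite ler_sqrt ?lerDl ?mulr_ge0// addr_ge0 ?mulr_ge0// ltW.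
Qed.

(** * Propagation of the KL bound through the levels *)

Section levels.
Context (R : realType) (d : nat) (Theta : set 'rV[R]_d)
  (pi_lim mu0 : density Theta) (pi : nat -> density Theta)
  (flow : nat -> density Theta -> R -> density Theta)
  (alpha k0 k1 k2 lambda s Rb : R).
Context (mTheta : measurable Theta)
  (alpha_gt0 : 0 < alpha) (k0_gt0 : 0 < k0) (k1_gt0 : 0 < k1) (k2_gt0 : 0 < k2)
  (lambda_gt0 : 0 < lambda) (s_gt1 : 1 < s)
  (KL_init : forall l, (1 <= l)%N -> (KL mu0 (pi l) <= k0%:E)%E)
  (KL_lim : forall l, (1 <= l)%N ->
    (KL (pi l) pi_lim <= (k1 * s `^ (- alpha * l%:R))%:E)%E)
  (KL_flow : forall l nu0 (t : R), (1 <= l)%N -> 0 <= t ->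
    (KL (flow l nu0 t) (pi l) <= (expR (- lambda * t))%:E * KL nu0 (pi l))%E)
  (KL_succ : forall l, (2 <= l)%N ->
    (KL (pi l.-1) (pi l) <= (k2 * s `^ (- alpha * l%:R))%:E)%E)
  (remainders : remainders_bounded_by pi flow mu0 Rb).

Lemma powR_level_lt1 (l : nat) : (1 <= l)%N -> s `^ (- alpha * l%:R) < 1.
Proof.
move=> l1; rewrite -ltr_ln ?posrE ?powR_gt0 ?(lt_trans _ s_gt1)//.
by rewrite ln1 ln_powR mulNr mulNr oppr_lt0 !mulr_gt0 ?ln_gt0// ltr0n.
Qed.

(** The price of changing the target while the distribution stays fixed: the bias between
    consecutive targets plus the remainder. *)
Lemma KL_mlsvgd_succ (T : nat -> R) (delta : R) (l : nat) :
  (forall k, 0 <= T k) -> (1 <= l)%N ->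
  (KL (mlsvgd flow mu0 T l) (pi l) <= delta%:E)%E ->
  (KL (mlsvgd flow mu0 T l) (pi l.+1) <=
    (delta + k2 * s `^ (- alpha * l.+1%:R) + Rb)%:E)%E.
Proof.
move=> T0 l1 KLl; have KLs := KL_succ l.+1 l1.
have [irem rem_le] := remainders T l.+1 T0 l1.
apply: le_trans (KL_le_remainder _ _ _ _ (pi l) _ mTheta _ _ irem) _.
- exact: le_lt_trans KLl (ltry _).
- exact: le_lt_trans KLs (ltry _).
- rewrite !EFinD; apply: leeD; first exact: leeD.
  by rewrite lee_fin.
Qed.

Lemma KL_mlsvgd1 (T : nat -> R) (delta : R) : (forall k, 0 <= T k) ->
  expR (- lambda * T 1%N) * k0 <= delta ->
  (KL (mlsvgd flow mu0 T 1) (pi 1) <= delta%:E)%E.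
Proof.
move=> T0 T1; apply: le_trans (KL_flow 1 mu0 (T 1%N) isT (T0 _)) _.
apply: le_trans (lee_wpmul2l _ (KL_init 1 isT)) _; first by rewrite lee_fin expR_ge0.
by rewrite -EFinM lee_fin.
Qed.

(* Flowing for a long time at level 1 makes KL(mu^(1) || pi^(1)) negligible, so
   that 0 <= KL(mu^(1) || pi^(2)) <= o(1) + k2 s^(-2 alpha) + R_2. *)
Lemma remainder_bound_gt : 0 < k2 + Rb.
Proof.
pose q := s `^ (- alpha * 2%:R).
have q1 : q < 1 by exact: powR_level_lt1.
(* Half the gap between k2 and k2 q: then delta + k2 q < k2, so 0 <= delta + k2 q + Rb gives a
   strict inequality. *)
pose delta := k2 * (1 - q) / 2.
have delta0 : 0 < delta by rewrite /delta !mulr_gt0// subr_gt0.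
pose t : R := Num.max 0 (ln (k0 / delta) / lambda).
have t0 : 0 <= t by rewrite le_max lexx.
have t1 : expR (- lambda * t) * k0 <= delta.
  rewrite mulNr expRN mulrC ler_pdivrMr ?expR_gt0// mulrC -ler_pdivrMr//.
  rewrite -[leLHS]lnK ?posrE ?(divr_gt0 k0_gt0 delta0)// ler_expR.
  rewrite -ler_pdivrMl// mulrC.
  by rewrite /t le_max lexx orbT.
have := KL_mlsvgd_succ (fun=> t) delta 1 (fun=> t0) isT
  (KL_mlsvgd1 _ _ (fun=> t0) t1).
move=> /(le_trans (KL_ge0 _ _ _ _ _ mTheta)); rewrite lee_fin -/q.
by rewrite /delta in delta0 *; lra.
Qed.

(** The bound [delta] is an invariant: changing the target raises it to at most [delta + k2 + Rb'],
    and the time spent on the new level brings it back. *)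
Lemma KL_mlsvgd (T : nat -> R) (delta Rb' : R) (l : nat) :
  (forall k, 0 <= T k) -> Rb <= Rb' ->
  expR (- lambda * T 1%N) * k0 <= delta ->
  (forall k, (2 <= k)%N -> expR (- lambda * T k) * (delta + k2 + Rb') <= delta) ->
  (1 <= l)%N -> (KL (mlsvgd flow mu0 T l) (pi l) <= delta%:E)%E.
Proof.
move=> T0 RbRb' T1 Tl; elim: l => // -[_ _|l /(_ isT) IH _].
  exact: KL_mlsvgd1.
apply: le_trans (KL_flow l.+2 (mlsvgd flow mu0 T l.+1) (T l.+2) isT (T0 _)) _.
have step := KL_mlsvgd_succ _ _ l.+1 T0 isT IH.
apply: le_trans (lee_wpmul2l _ step) _.
  by rewrite lee_fin expR_ge0.
rewrite -EFinM lee_fin; have := Tl l.+2 isT; apply: le_trans.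
rewrite ler_pM2l ?expR_gt0//; apply: lerD => //; rewrite lerD2l.
by rewrite ger_pMr// ltW// powR_level_lt1.
Qed.

(** Passing through [pi L], the sampling error and the bias each contribute at most eps^2 / 2 to the
    squared distance. *)
Lemma hellinger_mlsvgd (T : nat -> R) (eps : R) (L : nat) : 0 <= eps -> (1 <= L)%N ->
  (KL (mlsvgd flow mu0 T L) (pi L) <= (eps ^+ 2 / 2)%:E)%E ->
  2 * k1 * s `^ (- alpha * L%:R) <= eps ^+ 2 ->
  hellinger (mlsvgd flow mu0 T L) pi_lim <= eps.
Proof.
move=> eps0 L1 KL1 bias.
rewrite -(@ler_pXn2r _ 2)// ?nnegrE ?hellinger_ge0//.
apply: le_trans (sqr_hellingerD _ _ _ _ (pi L) _ mTheta) _.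
have := le_trans (sqr_hellinger_le_KL _ _ _ _ _ mTheta) KL1.
have := le_trans (sqr_hellinger_le_KL _ _ _ _ _ mTheta) (KL_lim L L1).
rewrite !lee_fin; lra.
Qed.

(** * Integration times and their cost *)

Context (c0 gamma : R) (c : nat -> R).
Context (c0_gt0 : 0 < c0) (gamma_gt0 : 0 < gamma)
  (cost_le : forall l, (1 <= l)%N -> c l <= c0 * s `^ (gamma * l%:R)).

Lemma mlsvgd_cost_le (T : nat -> R) (L : nat) : (forall l, 0 <= T l) ->
  mlsvgd_cost c T L <= c0 * \sum_(1 <= l < L.+1) (s `^ gamma) ^+ l * T l.
Proof.
move=> T0; rewrite mulr_sumr; apply: ler_sum_nat => l /andP[l1 _].
rewrite mulrA; apply: ler_wpM2r => //; apply: le_trans (cost_le _ l1) _.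
by rewrite powRrM powR_mulrn// powR_ge0.
Qed.

Let s_gt0 : 0 < s. Proof. exact: lt_trans s_gt1. Qed.
Let ln_s_gt0 : 0 < ln s. Proof. exact: ln_gt0. Qed.

Lemma powR_gamma_gt1 : 1 < s `^ gamma.
Proof.
by rewrite -ltr_ln ?posrE ?powR_gt0// ln1 ln_powR mulr_gt0.
Qed.

(** This is ln r <= r - 1 at r = s^gamma. It replaces the denominator r - 1 of the geometric sum by
    the gamma ln s of the cost bound. *)
Lemma gamma_ln_le : gamma * ln s <= s `^ gamma - 1.
Proof.
rewrite -ln_powR -[X in ln X](subrK 1) addrC le_ln1Dx//.
by rewrite ltrBrDl subrr powR_gt0.
Qed.

Lemma expR_schedule (eps A : R) : 0 < eps -> 0 <= A ->
  expR (- lambda * (2 * ln (Num.sqrt (eps ^+ 2 + 2 * A) / eps) / lambda)) =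
  eps ^+ 2 / (eps ^+ 2 + 2 * A).
Proof.
move=> eps0 A0; have e2 : 0 < eps ^+ 2 by exact: exprn_gt0.
have sum0 : 0 < eps ^+ 2 + 2 * A by rewrite ltr_wpDr// mulr_ge0.
set r := _ / eps; have r0 : 0 < r by rewrite divr_gt0// sqrtr_gt0.
have -> : - lambda * (2 * ln r / lambda) = - ln (r ^+ 2).
  by rewrite lnXn//; field; rewrite gt_eqF.
rewrite expRN lnK ?posrE ?exprn_gt0// /r expr_div_n sqr_sqrtr ?ltW//.
by rewrite invf_div.
Qed.

(* tau is the time in which eps^2 / 2 + k2 + Rb' decays to eps^2 / 2; the surplus
   tau1 - tau spent at level 1 is paid for by the -1 in r * (r ^+ L - 1). *)
Lemma mlsvgd_attains_schedule (Rb' eps tau tau1 : R) :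
  0 < eps -> eps <= Num.sqrt (2 * k1) -> Rb <= Rb' ->
  tau = 2 * ln (Num.sqrt (eps ^+ 2 + 2 * (k2 + Rb')) / eps) / lambda ->
  tau <= tau1 -> (s `^ gamma - 1) * (tau1 - tau) <= tau ->
  expR (- lambda * tau1) * k0 <= eps ^+ 2 / 2 ->
  mlsvgd_attains pi_lim flow mu0 c eps
    (mlsvgd_cost_bound c0 gamma alpha k1 k2 lambda s Rb' eps).
Proof.
move=> eps0 eps_le RbRb' tauE tau_le slack init.
have A0 : 0 < k2 + Rb'.
  by apply: lt_le_trans remainder_bound_gt _; rewrite lerD2l.
have e2 : 0 < eps ^+ 2 by exact: exprn_gt0.
have k10 : 0 < 2 * k1 by exact: mulr_gt0.
have sum0 : 0 < eps ^+ 2 + 2 * (k2 + Rb') by rewrite addr_gt0// mulr_gt0.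
have tau0 : 0 <= tau.
  rewrite tauE; apply: divr_ge0; last exact: ltW.
  by rewrite mulr_ge0// ln_ge0// sqrt_ratio_ge1// ltW.
pose B := Num.sqrt (2 * k1) / eps.
have B1 : 1 <= B by rewrite ler_pdivlMr// mul1r.
have B0 : 0 <= B by exact: le_trans B1.
(* Solves 2 k1 y^(- alpha) = eps^2, so any level with s^L >= y has a small enough bias. *)
pose y := B `^ (2 / alpha).
have y1 : 1 <= y.
  by rewrite -(powRr0 B) ler_powR// divr_ge0// ltW.
have y0 : 0 <= y by exact: le_trans y1.
have [L L1 /andP[y_le sL_le]] := exists_level _ _ _ s_gt1 y1.
pose T l := if l == 1%N then tau1 else tau.
have T0 l : 0 <= T l by rewrite /T; case: ifP => // _; exact: le_trans tau_le.
exists L, T; split => //.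
  apply: hellinger_mlsvgd => //; first exact: ltW.
    apply: (KL_mlsvgd _ _ Rb') => // k k2'.
    rewrite /T gtn_eqF// tauE expR_schedule ?(ltW A0)//.
    rewrite (_ : eps ^+ 2 / 2 + k2 + Rb' = (eps ^+ 2 + 2 * (k2 + Rb')) / 2).
      by rewrite mulrA divfK// gt_eqF.
    by field.
  have : y `^ alpha <= (s `^ L%:R) `^ alpha.
    by apply: ge0_ler_powR; rewrite ?nnegrE ?powR_ge0// ltW.
  rewrite /y -!powRrM divfK ?gt_eqF// powR_mulrn// /B expr_div_n.
  rewrite sqr_sqrtr ?(ltW k10)// ler_pdivrMr// => bias.
  by rewrite mulNr powRN ler_pdivrMr ?powR_gt0// [leRHS]mulrC (mulrC alpha).
apply: le_trans (mlsvgd_cost_le _ _ T0) _.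
rewrite /mlsvgd_cost_bound -/B.
have -> : s `^ (2 * gamma) = (s `^ gamma) ^+ 2.
  by rewrite mulrC powRrM powR_mulrn// powR_ge0.
(* Rounding [L] up costs one factor s^gamma; the geometric sum contributes the other one in the
   bound. *)
have rL_le : (s `^ gamma) ^+ L <= s `^ gamma * B `^ (2 * gamma / alpha).
  have : (s `^ L%:R) `^ gamma <= (s * y) `^ gamma.
    apply: ge0_ler_powR; rewrite ?nnegrE ?powR_ge0//; first exact: ltW.
    by rewrite mulr_ge0// ltW.
  rewrite powRM ?(ltW s_gt0)// (_ : (s `^ L%:R) `^ gamma = (s `^ gamma) ^+ L).
    by rewrite /y -powRrM mulrAC.
  by rewrite -powRrM mulrC powRrM powR_mulrn// powR_ge0.
have r1 := powR_gamma_gt1; have lnr := gamma_ln_le.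
set r := s `^ gamma in r1 lnr rL_le slack *.
set Y := B `^ _ in rL_le *.
have gl0 : 0 < gamma * ln s by exact: mulr_gt0.
have SE : \sum_(1 <= l < L.+1) r ^+ l * T l =
    r * (tau1 - tau) + tau * \sum_(1 <= l < L.+1) r ^+ l.
  rewrite big_ltn// [in RHS]big_ltn// {1}/T eqxx.
  rewrite (eq_big_nat _ _ (F2 := fun l => tau * r ^+ l)); last first.
    by move=> l /andP[l2 _]; rewrite /T gtn_eqF// mulrC.
  by rewrite -mulr_sumr; ring.
have S0 : 0 <= \sum_(1 <= l < L.+1) r ^+ l * T l.
  apply: sumr_ge0 => l _; rewrite mulr_ge0// exprn_ge0// ltW//.
  exact: lt_trans r1.
have S_le : (r - 1) * \sum_(1 <= l < L.+1) r ^+ l * T l <= tau * (r ^+ 2 * Y).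
  rewrite SE mulrDr [X in _ + X]mulrCA sum_expr_geom mulrCA.
  apply: (@le_trans _ _ (r * tau + tau * (r * (r ^+ L - 1)))).
    by rewrite lerD2r ler_pM2l// (lt_trans _ r1).
  rewrite (_ : _ + _ = tau * (r * r ^+ L)); last by ring.
  rewrite ler_wpM2l// expr2 -mulrA ler_pM2l// (lt_trans _ r1)//.
rewrite (_ : 2 * c0 * _ / _ * _ * _ = c0 * (tau * (r ^+ 2 * Y) / (gamma * ln s))).
  rewrite ler_pM2l// ler_pdivlMr//; apply: le_trans S_le.
  by rewrite mulrC ler_wpM2r.
by rewrite tauE; field; rewrite !gt_eqF.
Qed.

Lemma mlsvgd_attains_explicit (Rb' eps : R) : Rb <= Rb' ->
  0 < eps -> eps <= Num.sqrt (2 * k1) -> k0 <= eps ^+ 2 / 2 + k2 + Rb' ->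
  mlsvgd_attains pi_lim flow mu0 c eps
    (mlsvgd_cost_bound c0 gamma alpha k1 k2 lambda s Rb' eps).
Proof.
move=> RbRb' eps0 eps_le k0_le.
have A0 : 0 < k2 + Rb'.
  by apply: lt_le_trans remainder_bound_gt _; rewrite lerD2l.
have e2 : 0 < eps ^+ 2 by exact: exprn_gt0.
set A := k2 + Rb' in A0 *.
have sum0 : 0 < eps ^+ 2 + 2 * A by rewrite addr_gt0// mulr_gt0.
have ratio_ge1 := sqrt_ratio_ge1 _ _ _ eps0 (ltW A0).
apply: (mlsvgd_attains_schedule _ _ _ _ eps0 eps_le RbRb' erefl (lexx _)).
  rewrite subrr mulr0; apply: divr_ge0; last exact: ltW.
  by rewrite mulr_ge0// ln_ge0.
rewrite expR_schedule ?(ltW A0)// mulrAC ler_pdivrMr// -[leRHS]mulrA ler_pM2l//.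
by rewrite /A; lra.
Qed.

Lemma mlsvgd_attains_small : exists2 eps0 : R, 0 < eps0 &
  forall eps : R, 0 < eps -> eps <= eps0 ->
    mlsvgd_attains pi_lim flow mu0 c eps
      (mlsvgd_cost_bound c0 gamma alpha k1 k2 lambda s Rb eps).
Proof.
have A0 := remainder_bound_gt.
have r1 := powR_gamma_gt1.
(* The surplus time D / lambda multiplies the divergence at level 1 by A / (A + k0), where A = k2 +
   Rb. As k0 A / (A + k0) <= A, the level then ends below eps^2 / 2. *)
pose D := ln (1 + k0 / (k2 + Rb)).
have D0 : 0 <= D by rewrite ln_ge0// lerDl divr_ge0 ?ltW.
pose M := (s `^ gamma - 1) * D.
(* If eps^2 <= a, then (eps^2 + 2 A) / eps^2 >= exp M, that is, lambda tau >= M. This is the slack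
   condition for the surplus D / lambda. *)
pose a := 2 * (k2 + Rb) * expR (- M).
have a0 : 0 < a by rewrite /a !mulr_gt0 ?expR_gt0.
exists (Num.min (Num.sqrt (2 * k1)) (Num.sqrt a)).
  by rewrite lt_min !sqrtr_gt0 a0 andbT mulr_gt0.
move=> eps eps0; rewrite le_min => /andP[eps_le eps_le_a].
have e2 : 0 < eps ^+ 2 by exact: exprn_gt0.
have e2_le : eps ^+ 2 <= a.
  by rewrite -(sqr_sqrtr (ltW a0)) ler_pXn2r ?nnegrE ?sqrtr_ge0// ltW.
have sum0 : 0 < eps ^+ 2 + 2 * (k2 + Rb) by rewrite addr_gt0// mulr_gt0.
have M_le : M <= 2 * ln (Num.sqrt (eps ^+ 2 + 2 * (k2 + Rb)) / eps).
  set q := _ / eps; have q0 : 0 < q by rewrite divr_gt0// sqrtr_gt0.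
  have -> : 2 * ln q = ln (q ^+ 2) by rewrite lnXn// mulr_natl.
  rewrite -ler_expR lnK ?posrE ?exprn_gt0// /q expr_div_n sqr_sqrtr ?(ltW sum0)//.
  rewrite ler_pdivlMr// mulrC -ler_pdivlMr ?expR_gt0// -expRN.
  apply: (le_trans e2_le); rewrite ler_pM2r ?expR_gt0//.
  by rewrite lerDr ltW.
set l := ln _ in M_le.
apply: (mlsvgd_attains_schedule _ _ (2 * l / lambda) (2 * l / lambda + D / lambda)
  eps0 eps_le (lexx _)) => //.
- by rewrite lerDl divr_ge0// ltW.
- by rewrite addrAC subrr add0r mulrA ler_pM2r ?invr_gt0.
rewrite mulrDr expRD expR_schedule ?(ltW A0)//.
have -> : - lambda * (D / lambda) = - D by field; rewrite gt_eqF.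
have k0A0 : 0 < 1 + k0 / (k2 + Rb) by rewrite addr_gt0// divr_gt0.
rewrite expRN lnK ?posrE//.
have -> : eps ^+ 2 / (eps ^+ 2 + 2 * (k2 + Rb)) / (1 + k0 / (k2 + Rb)) * k0 =
    eps ^+ 2 * (k2 + Rb) * k0 /
      ((eps ^+ 2 + 2 * (k2 + Rb)) * (k2 + Rb + k0)).
  by field; rewrite !gt_eqF// addr_gt0.
rewrite ler_pdivrMr; last by rewrite mulr_gt0// addr_gt0.
rewrite -!mulrA ler_pM2l//.
have := mulr_gt0 e2 A0; have := mulr_gt0 e2 k0_gt0; have := mulr_gt0 A0 A0.
nra.
Qed.

Lemma mlsvgd_attains_large : exists2 R0 : R, Rb <= R0 &
  forall Rb' : R, R0 <= Rb' -> forall eps : R, 0 < eps ->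
    mlsvgd_attains pi_lim flow mu0 c eps
      (mlsvgd_cost_bound c0 gamma alpha k1 k2 lambda s Rb' eps).
Proof.
have r1 := powR_gamma_gt1.
have r0 : 0 < s `^ gamma by exact: lt_trans r1.
have k10 : 0 < 2 * k1 by exact: mulr_gt0.
(* In this time [k0] decays to k0 k1 / (k0 + k1) <= k1, which is below eps^2 / 2 when eps > sqrt (2
   k1). The summand 1 keeps [t] nonnegative. *)
pose t := ln (1 + k0 / k1) / lambda.
have t0 : 0 <= t.
  by rewrite divr_ge0 ?(ltW lambda_gt0)// ln_ge0// lerDl divr_ge0// ltW.
(* For eps <= 1, c0 q bounds from below the factor in front of the logarithm in the cost bound. A
   logarithm of at least [M] therefore pays for one level run for time [t]. *)
pose q := 2 * (s `^ gamma) ^+ 2 / (lambda * gamma * ln s) *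
  (Num.sqrt (2 * k1)) `^ (2 * gamma / alpha).
have q0 : 0 < q.
  apply: mulr_gt0; last by rewrite powR_gt0// sqrtr_gt0.
  by apply: divr_gt0; rewrite !mulr_gt0// exprn_gt0.
pose M := s `^ gamma * t / q.
(* [k0] gives the condition of [mlsvgd_attains_explicit]; the square of exp M makes the logarithm at
   least [M] for every eps < 1. *)
exists (Num.max Rb (Num.max k0 (expR M ^+ 2))); first by rewrite le_max lexx.
move=> Rb'; rewrite !ge_max => /and3P[RbRb' k0Rb' MRb'] eps eps0.
have A0 : 0 < k2 + Rb' by rewrite addr_gt0// (lt_le_trans k0_gt0).
have e2 : 0 < eps ^+ 2 by exact: exprn_gt0.
have sum0 : 0 < eps ^+ 2 + 2 * (k2 + Rb') by rewrite addr_gt0// mulr_gt0.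
have [eps_le|eps_gt] := leP eps (Num.sqrt (2 * k1)).
  apply: mlsvgd_attains_explicit => //; apply: le_trans k0Rb' _.
  by rewrite lerDr addr_ge0// ?divr_ge0// ltW.
have ratio_ge1 := sqrt_ratio_ge1 _ _ _ eps0 (ltW A0).
have [eps_ge1|eps_lt1] := leP 1 eps.
  (* Zero integration time costs nothing, and the bound is nonnegative. *)
  exists 1%N, (fun=> 0); split => //.
    exact: le_trans (hellinger_le1 _ _ _ _ _ mTheta) eps_ge1.
  rewrite /mlsvgd_cost big1//; last by move=> l _; rewrite mulr0.
  rewrite /mlsvgd_cost_bound mulr_ge0 ?ln_ge0// mulr_ge0 ?powR_ge0//.
  by rewrite divr_ge0// ?mulr_ge0 ?powR_ge0// ltW.
have e2_gt : 2 * k1 < eps ^+ 2.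
  by rewrite -(sqr_sqrtr (ltW k10)) ltr_pXn2r ?nnegrE ?sqrtr_ge0// ltW.
(* Since 2 k1 < eps^2, the bias is already small enough at level 1. *)
exists 1%N, (fun=> t); split => //.
  apply: hellinger_mlsvgd => //; first exact: ltW.
    apply: KL_mlsvgd1 => //; rewrite /t.
    have -> : - lambda * (ln (1 + k0 / k1) / lambda) = - ln (1 + k0 / k1).
      by field; rewrite gt_eqF.
    have k01 : 0 < 1 + k0 / k1 by rewrite addr_gt0// divr_gt0.
    rewrite expRN lnK ?posrE//.
    have -> : (1 + k0 / k1)^-1 * k0 = k1 * (k0 / (k1 + k0)).
      by field; rewrite !gt_eqF// addr_gt0.
    apply: (@le_trans _ _ k1); last by rewrite ler_pdivlMr// mulrC ltW.
    by rewrite ger_pMr// ler_pdivrMr ?addr_gt0// mul1r lerDr ltW.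
  apply: le_trans (ltW e2_gt); rewrite ger_pMr//.
  exact/ltW/powR_level_lt1.
apply: le_trans (mlsvgd_cost_le _ _ (fun=> t0)) _.
rewrite big_nat1 expr1 /mlsvgd_cost_bound.
have -> : s `^ (2 * gamma) = (s `^ gamma) ^+ 2.
  by rewrite mulrC powRrM powR_mulrn// ltW.
set B := Num.sqrt (2 * k1) / eps.
have B_ge : (Num.sqrt (2 * k1)) `^ (2 * gamma / alpha) <= B `^ (2 * gamma / alpha).
  apply: ge0_ler_powR; rewrite ?nnegrE ?sqrtr_ge0//.
  - by rewrite divr_ge0 ?mulr_ge0// ltW.
  - by rewrite divr_ge0 ?sqrtr_ge0// ltW.
  - by rewrite ler_pdivlMr// ler_piMr ?sqrtr_ge0// ltW.
have M_le : M <= ln (Num.sqrt (eps ^+ 2 + 2 * (k2 + Rb')) / eps).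
  rewrite -ler_expR lnK ?posrE ?(lt_le_trans _ ratio_ge1)//.
  rewrite ler_pdivlMr//; apply: (@le_trans _ _ (expR M)).
    by rewrite ler_piMr ?expR_ge0// ltW.
  rewrite -[leLHS](ger0_norm (expR_ge0 _)) -sqrtr_sqr ler_sqrt ?(ltW sum0)//.
  by have := e2; have := k2_gt0; have := k0_gt0; lra.
rewrite -!mulrA [2 * _]mulrCA ler_pM2l//.
apply: (@le_trans _ _ (q * M)); first by rewrite /M [leRHS]mulrC divfK// gt_eqF.
apply: (@le_trans _ _
    (q * ln (Num.sqrt (eps ^+ 2 + 2 * (k2 + Rb')) / eps))).
  by rewrite ler_pM2l.
rewrite !mulrA ler_wpM2r ?ln_ge0// /q expr2 [2 * (_ * _)]mulrA ler_wpM2l//.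
by rewrite divr_ge0// !mulr_ge0// ltW.
Qed.

End levels.

Theorem proposition2 (R : realType) (d : nat)
  (Theta : set 'rV[R]_d) (mTheta : measurable Theta)
  (pi_lim mu0 : density Theta) (pi : nat -> density Theta)
  (hweak : weak_cvg pi pi_lim)
  (K : 'rV[R]_d -> 'rV[R]_d -> R) (hK : reproducing_kernel K)
  (flow : nat -> density Theta -> R -> density Theta)
  (hflow : forall (l : nat) (nu0 : density Theta), (1 <= l)%N ->
     mean_field_svgd K (pi l) nu0 (flow l nu0))
  (c : nat -> R) (c0 gamma alpha k0 k1 k2 lambda s : R)
  (c0_gt0 : 0 < c0) (gamma_gt0 : 0 < gamma) (alpha_gt0 : 0 < alpha)
  (k0_gt0 : 0 < k0) (k1_gt0 : 0 < k1) (k2_gt0 : 0 < k2)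
  (lambda_gt0 : 0 < lambda) (s_gt1 : 1 < s)
  (hi : forall l : nat, (1 <= l)%N -> c l <= c0 * s `^ (gamma * l%:R))
  (hii : forall l : nat, (1 <= l)%N ->
     (KL mu0 (pi l) <= k0%:E)%E /\
     (KL (pi l) pi_lim <= (k1 * s `^ (- alpha * l%:R))%:E)%E)
  (hiii : forall (l : nat) (nu0 : density Theta) (nu : R -> density Theta),
     (1 <= l)%N -> mean_field_svgd K (pi l) nu0 nu ->
     forall t : R, 0 <= t ->
       (KL (nu t) (pi l) <= (expR (- lambda * t))%:E * KL nu0 (pi l))%E)
  (hiv : forall l : nat, (2 <= l)%N ->
     (KL (pi l.-1) (pi l) <= (k2 * s `^ (- alpha * l%:R))%:E)%E)
  (Rb : R) (hRb : remainders_bounded_by pi flow mu0 Rb) :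
  let attains (Rb' eps : R) :=
    mlsvgd_attains pi_lim flow mu0 c eps
      (mlsvgd_cost_bound c0 gamma alpha k1 k2 lambda s Rb' eps) in
  [/\ (* all tolerances, all sufficiently large bounds on the remainders *)
      exists2 R0 : R, Rb <= R0 &
        forall Rb' : R, R0 <= Rb' -> forall eps : R, 0 < eps -> attains Rb' eps,
      (* an arbitrary bound on the remainders, small tolerances *)
      exists2 eps0 : R, 0 < eps0 &
        forall eps : R, 0 < eps -> eps <= eps0 -> attains Rb eps &
      (* an arbitrary bound on the remainders, explicit tolerances *)
      forall eps : R, 0 < eps -> eps <= Num.sqrt (2 * k1) ->
        k0 <= eps ^+ 2 / 2 + k2 + Rb -> attains Rb eps].
Proof.
(* [hiii] concerns every solution, so [hflow] passes its decay on to [flow]. *)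
have KL_flow l (nu0 : density Theta) (t : R) : (1 <= l)%N -> 0 <= t ->
    (KL (flow l nu0 t) (pi l) <= (expR (- lambda * t))%:E * KL nu0 (pi l))%E.
  by move=> l1; apply: hiii => //; exact: hflow.
have init l : (1 <= l)%N -> (KL mu0 (pi l) <= k0%:E)%E by move=> /hii[].
have lim l : (1 <= l)%N ->
    (KL (pi l) pi_lim <= (k1 * s `^ (- alpha * l%:R))%:E)%E by move=> /hii[].
split.
- exact: (@mlsvgd_attains_large R d Theta pi_lim mu0 pi flow alpha k0 k1 k2).
- exact: (@mlsvgd_attains_small R d Theta pi_lim mu0 pi flow alpha k0 k1 k2).
- move=> eps eps0 eps_le k0_le.
  exact: (@mlsvgd_attains_explicit R d Theta pi_lim mu0 pi flow alpha k0 k1 k2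
    lambda s Rb).
Qed.
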